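(* Let $n\ge1$, let $A$ be a symmetric complex $n\times n$ matrix of rank $r$ with $1\le r\le n$, and let $U\in GL(n,\mathbb{C})$ be such that $A=U\begin{pmatrix} I_{r\times r}&0\\0&0\end{pmatrix}U^\tau$. Then, for any $P(z)\in\mathcal{A}_n$, $P$ is $\Delta_A$-nilpotent if and only if the submatrix of $U^\tau(\mathrm{Hes}\,P)\,U$ consisting of the first $r$ rows and $r$ columns is nilpotent. In particular, when $r=n$ (i.e. $\Delta_A$ is of full rank), any $P(z)\in\mathcal{A}_n$ is $\Delta_A$-nilpotent if and only if $U^\tau(\mathrm{Hes}\,P)\,U$ is nilpotent.
   Context: $\mathcal{A}_n=\mathbb{C}[z_1,\dots,z_n]$, $D_i=\partial/\partial z_i$, $\Delta_A=\sum_{i,j=1}^n a_{ij}D_iD_j$ for a symmetric matrix $A=(a_{ij})$, and $\mathrm{Hes}\,P=\left(\frac{\partial^2P}{\partial z_i\partial z_j}\right)_{n\times n}$. $U^\tau$ is the transpose of $U$. $P$ is $\Delta_A$-nilpotent if $\Delta_A^m(P^m)=0$ for all $m\ge1$. Nilpotency of a matrix is as a matrix with entries in $\mathcal{A}_n$. *)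

(* Defs.v *)
From HB Require Import structures.
From mathcomp Require Import all_boot all_order all_algebra.
From mathcomp Require Import reals complex mpoly.

Set Implicit Arguments.
Unset Strict Implicit.
Unset Printing Implicit Defensive.

Import GRing.Theory.

Local Open Scope ring_scope.

Section Laplacian.
Variables (K : comNzRingType) (n : nat).
Implicit Types (A : 'M[K]_n) (P : {mpoly K[n]}).

Definition Laplacian A P : {mpoly K[n]} :=
  \sum_(i < n) \sum_(j < n) A i j *: P^`M(j)^`M(i).

Definition Hessian P : 'M[{mpoly K[n]}]_n :=
  \matrix_(i < n, j < n) P^`M(j)^`M(i).

Definition Laplacian_nilpotent A P : Prop :=
  forall m : nat, (1 <= m)%N -> iter m (Laplacian A) (P ^+ m) = 0.

Definition mpolyC_mx m p (M : 'M[K]_(m, p)) : 'M[{mpoly K[n]}]_(m, p) :=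
  map_mx (@mpolyC n K) M.

End Laplacian.

Arguments mpolyC_mx {K} n {m p} M.

Definition nilpotent_mx (S : pzRingType) (k : nat) (M : 'M[S]_k) : Prop :=
  exists m : nat, M ^+ m = 0.

Definition leading_submx (S : Type) (n r : nat) (le_rn : (r <= n)%N)
    (M : 'M[S]_n) : 'M[S]_r :=
  mxsub (widen_ord le_rn) (widen_ord le_rn) M.

(* Main.v *)
(* Let D_1', ..., D_r' be the directional derivatives along the first r columns
   of U: then Delta_A = sum_k D_k'^2, and the r x r block of U^T (Hes P) U is
   H(P) = (D_k' D_l' P), so no change of variables is needed.  With grad = (D_k')
   and Delta = Delta_A, let Q be the power series in t with Q(0) = P and
   2 dQ/dt = <grad Q, grad Q>.  Both conditions on P are equivalent to Delta Q = 0.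
   First, 2 (k+1) d(Q^k)/dt = Delta(Q^(k+1)) - (k+1) Q^k Delta Q, so as long as
   Delta Q vanishes to order j, the coefficients of Q^k up to t^j are nonzero
   multiples of the Delta^i (P^(k+i)).  Second, the derivation
   d = d/dt - sum_k (D_k' Q) D_k' satisfies d H(Q) = H(Q)^2, hence
   d tr(H(Q)^m) = m tr(H(Q)^(m+1)): the trace of H(Q) vanishes iff the traces of
   all powers of H(Q) vanish at t = 0, that is, iff H(P) is nilpotent. *)

Require Import Defs.
From HB Require Import structures.
From mathcomp Require Import all_boot all_order all_algebra.
From mathcomp Require Import ring reals complex mpoly.

Set Implicit Arguments.
Unset Strict Implicit.
Unset Printing Implicit Defensive.

Import GRing.Theory.

Local Open Scope ring_scope.

(** * Nilpotency of a matrix through the traces of its powers *)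

Lemma map_mxtraceX (S T : nzRingType) (f : {rmorphism S -> T}) n
    (M : 'M[S]_n) k :
  f (\tr (M ^+ k)) = \tr (map_mx f M ^+ k).
Proof. by rewrite -trace_map_mx; congr (\tr _); exact: rmorphXn. Qed.

(** In a rank factorisation E = C B, idempotence forces B C = 1, and tr(C B) = tr(B C). *)
Lemma mxtrace_idempotent (F : fieldType) n (E : 'M[F]_n) :
  E *m E = E -> \tr E = (\rank E)%:R.
Proof.
move=> idE; have /row_fullP[L] := col_base_full E.
have := mulmx_base E.
move: (col_base E) (row_base E) (row_base_free E) => C B freeB defE LC1.
have BC1 : B *m C = 1%:M.
  apply: (row_free_inj freeB); move: idE; rewrite -{1 2}defE -[RHS]defE.
  by move/(congr1 (mulmx L)); rewrite !mulmxA LC1 !mul1mx.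
by rewrite -[E in LHS]defE mxtrace_mulC BC1 mxtrace1.
Qed.

(** Induction on the size: M is singular, so a rank factorisation M = C B gives a smaller matrix B
    C, again nilpotent and with the same trace. *)
Lemma mxtrace_nilpotent (F : fieldType) n (M : 'M[F]_n) :
  nilpotent_mx M -> \tr M = 0.
Proof.
have [s] := ubnP n; elim: s n M => // s IHs n M /ltnSE le_ns [m Mm0].
have [n0|n_gt0] := posnP n.
  by apply: big1 => i _; have := leq_ltn_trans (leq0n i) (ltn_ord i); rewrite {1}n0.
have lt_rn : (\rank M < n)%N.
  rewrite ltn_neqAle rank_leq_row andbT; apply/negP => rM.
  have uM : M \in unitmx by rewrite -row_free_unit.
  have : 1%:M = 0 :> 'M[F]_n.
    elim: m Mm0 => [|m IHm]; first by [].
    rewrite exprS => MM0; apply: IHm; apply: (can_inj (mulKmx uM)).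
    by rewrite mulmx0.
  move=> /(congr1 mxrank); rewrite mxrank1 mxrank0 => n0.
  by rewrite n0 in n_gt0.
have := mulmx_base M; move: (col_base M) (row_base M) => C B defM.
rewrite -[in LHS]defM mxtrace_mulC; apply: (IHs _ _ (leq_trans lt_rn le_ns)).
have powBC k : (B *m C) ^+ k.+1 = B *m M ^+ k *m C.
  elim: k => [|k IHk]; first by rewrite expr1 expr0 mulmx1.
  have -> : M ^+ k.+1 = M ^+ k *m (C *m B) by rewrite defM exprSr.
  by rewrite exprSr IHk -[LHS]/(_ *m (B *m C)) !mulmxA.
by exists m.+1; rewrite powBC Mm0 mulmx0 mul0mx.
Qed.

(** Write the characteristic polynomial as q X^m with q(0) nonzero. A Bezout relation u X^(m+1) + v
    q = 1 yields the Fitting projector E onto the part where M is invertible. Its rank equals its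
    trace, which is 0, so E = 0 and M^m = 0. *)
Lemma nilpotent_of_mxtrace (F : fieldType) n (M : 'M[F]_n) :
    [pchar F] =i pred0 -> (forall k, (1 <= k)%N -> \tr (M ^+ k) = 0) ->
  nilpotent_mx M.
Proof.
case: n M => [|n] M char0 trM; first by exists 0; apply/matrixP => -[].
have [m [q]] := multiplicity_XsubC (char_poly M) 0.
rewrite monic_neq0 ?char_poly_monic //= subr0 => q0 defp.
have /Bezout_eq1_coprimepP[[u v] /= uv1] : coprimep ('X ^+ m.+1) q.
  by rewrite coprimep_expl // coprimep_sym -['X]subr0 coprimep_XsubC.
have CH : horner_mx M (q * 'X ^+ m) = 0.
  by rewrite -defp Cayley_Hamilton.
pose E := horner_mx M (u * 'X ^+ m.+1).
have idE : E *m E = E.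
  rewrite -[RHS]mulr1 -(rmorph1 (horner_mx M)) -uv1 rmorphD mulrDr -/E.
  suff -> : E * horner_mx M (v * q) = 0 by rewrite addr0.
  rewrite -[LHS]rmorphM /=.
  have -> : u * 'X^(m.+1) * (v * q) = u * v * 'X * (q * 'X^m).
    by rewrite exprS; ring.
  by rewrite rmorphM /= CH mulr0.
(* E is a polynomial in M without constant term. *)
have trE : \tr E = 0.
  rewrite /E exprSr mulrA -[u * _]coefK poly_def mulr_suml !raddf_sum /=.
  apply: big1 => i _; rewrite -scalerAl -exprSr linearZ /= rmorphXn /= horner_mx_X.
  by rewrite mxtraceZ trM ?mulr0.
have E0 : E = 0.
  apply/eqP; rewrite -mxrank_eq0; move/eqP: (mxtrace_idempotent idE).
  by rewrite trE eq_sym (pcharf0P F).1.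
exists m; rewrite -(horner_mx_X M) -rmorphXn /=.
rewrite -[X in horner_mx M X]mul1r -uv1 mulrDl rmorphD [X in X + _]rmorphM /= -/E.
by rewrite E0 mul0r add0r -mulrA rmorphM /= CH mulr0.
Qed.

(** Both conditions can be tested in the fraction field, into which S embeds. *)
Lemma nilpotent_mx_tracesP (S : idomainType) n (M : 'M[S]_n) :
    [pchar S] =i pred0 ->
  nilpotent_mx M <-> forall k, (1 <= k)%N -> \tr (M ^+ k) = 0.
Proof.
move=> char0; pose f : {rmorphism S -> {fraction S}} := @tofrac S.
have charF : [pchar {fraction S}] =i pred0.
  move=> p; rewrite -[RHS](char0 p) !inE -(rmorph_nat f) /=.
  by rewrite tofrac_eq0.
have f_inj : injective f by move=> x y /eqP; rewrite tofrac_eq => /eqP.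
have nilf : nilpotent_mx M <-> nilpotent_mx (map_mx f M).
  split=> -[m Mm]; exists m; first by rewrite -rmorphXn Mm rmorph0.
  apply/matrixP => i j; apply: f_inj.
  have -> : f ((M ^+ m) i j) = map_mx f (M ^+ m) i j by rewrite mxE.
  by rewrite rmorphXn Mm !mxE rmorph0.
rewrite nilf; split=> [nilM k k_gt0|trM].
  apply: f_inj; rewrite map_mxtraceX rmorph0; apply: mxtrace_nilpotent.
  case: nilM => m Mm; exists m.
  by rewrite -exprM mulnC exprM Mm expr0n; case: k k_gt0.
by apply: nilpotent_of_mxtrace => // k k_gt0; rewrite -map_mxtraceX trM ?rmorph0.
Qed.

(** * Derivations, and the Laplacian of a power *)

Definition leibniz (B : comNzRingType) (d : B -> B) : Prop :=
  forall x y, d (x * y) = d x * y + x * d y.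

Section Derivation.
Variables (B : comNzRingType) (d : {additive B -> B}) (dM : leibniz d).

Lemma leibnizX x k : d (x ^+ k) = (x ^+ k.-1 * d x) *+ k.
Proof.
elim: k => [|k IHk] /=.
  (* For k = 0 the claim is d 1 = 0, obtained by cancelling d 1 in d(1 * 1) = d 1 + d 1. *)
  rewrite expr0 mulr0n; apply: (addrI (d 1)); rewrite addr0.
  have := dM 1 1; rewrite !mulr1 mul1r; exact: esym.
rewrite exprS dM IHk mulrnAr mulrSr addrC; congr (_ + _); last by rewrite mulrC.
by case: k {IHk} => [|k]; rewrite ?mulr0n // mulrA -exprS.
Qed.

Lemma leibniz_mx n (M N : 'M[B]_n) :
  map_mx d (M *m N) = map_mx d M *m N + M *m map_mx d N.
Proof.
apply/matrixP => i j; rewrite !mxE raddf_sum -big_split /=.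
by apply: eq_bigr => k _; rewrite dM !mxE.
Qed.

Lemma leibniz_mxtraceX n (M : 'M[B]_n) k :
  d (\tr (M ^+ k)) = \tr (M ^+ k.-1 *m map_mx d M) *+ k.
Proof.
(* The factor X commuting with M makes the induction on k go through. *)
have trC (X : 'M[B]_n) : M * X = X * M ->
    \tr (X * map_mx d (M ^+ k)) = \tr (X * (M ^+ k.-1 *m map_mx d M)) *+ k.
  elim: k X => [|k IHk] X MX.
    rewrite expr0; have -> : map_mx d (1 : 'M[B]_n) = 0.
      apply/matrixP => i j; rewrite !mxE; case: (_ == _); last by rewrite raddf0.
      by have := leibnizX 1 0; rewrite expr0 mulr0n.
    by rewrite mulr0 mxtrace0 mulr0n.
  have XM : M * (X * M) = (X * M) * M by rewrite !mulrA MX.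
  rewrite exprS leibniz_mx mulrDr mxtraceD [X * (M *m _)]mulrA IHk // mulrSr addrC.
  congr (_ + _).
    case: k {IHk} => [|k]; rewrite ?mulr0n //=.
    by rewrite -[M ^+ k *m _]/(_ * _) -[M ^+ k.+1 *m _]/(_ * _) exprS !mulrA.
  have comMX l : M ^+ l * X = X * M ^+ l.
    by elim: l => [|l IHl]; rewrite ?mulr1 ?mul1r // exprSr -mulrA MX !mulrA IHl.
  rewrite [LHS](mxtrace_mulC X) -[_ *m X]/(map_mx d M * M ^+ k * X).
  by rewrite -mulrA comMX [LHS]mxtrace_mulC -[_ *m _]/(X * M ^+ k * _) -mulrA.
have -> : d (\tr (M ^+ k)) = \tr (map_mx d (M ^+ k)).
  by rewrite raddf_sum; apply: eq_bigr => i _; rewrite mxE.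
have := trC 1; rewrite !mul1r => ->//.
by rewrite mulr1.
Qed.

End Derivation.

Section LaplaceHessian.
Variables (r : nat) (B : comNzRingType) (D : 'I_r -> B -> B).

Definition lap x := \sum_k D k (D k x).
Definition gradsq x := \sum_k D k x ^+ 2.
Definition hess x : 'M[B]_r := \matrix_(k, l) D k (D l x).

End LaplaceHessian.

Lemma lapX r (B : comNzRingType) (D : 'I_r -> {additive B -> B}) x k :
    (forall i, leibniz (D i)) ->
  lap D (x ^+ k.+1)
  = (x ^+ k * lap D x) *+ k.+1 + (x ^+ k.-1 * gradsq D x) *+ (k.+1 * k).
Proof.
move=> DM; rewrite /lap /gradsq !mulr_sumr -!sumrMnl -big_split /=.
apply: eq_bigr => i _; rewrite leibnizX // raddfMn DM leibnizX //= mulrnDl addrC.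
by congr (_ + _); rewrite mulrnAl -mulrA -expr2 -mulrnA mulnC.
Qed.

(** * Vanishing orders in t *)

Section Low.
Variable (A : comNzRingType).
Implicit Types (p q : {poly A}).

(* p = O(t^N); power series in t are handled as polynomials modulo t^N. *)
Definition low N p : Prop := forall i, (i < N)%N -> p`_i = 0.

Lemma low0 N : low N 0. Proof. by move=> i _; rewrite coef0. Qed.

Lemma low_le M N p : (M <= N)%N -> low N p -> low M p.
Proof. by move=> MN lp i iM; apply: lp; apply: leq_trans MN. Qed.

Lemma lowD N p q : low N p -> low N q -> low N (p + q).
Proof. by move=> lp lq i iN; rewrite coefD lp // lq // addr0. Qed.

Lemma lowN N p : low N p -> low N (- p).
Proof. by move=> lp i iN; rewrite coefN lp // oppr0. Qed.

Lemma lowMn N p k : low N p -> low N (p *+ k).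
Proof. by move=> lp i iN; rewrite coefMn lp // mul0rn. Qed.

Lemma lowMl N p q : low N q -> low N (p * q).
Proof.
move=> lq i iN; rewrite coefM big1 // => j _.
by rewrite lq ?mulr0 // (leq_ltn_trans (leq_subr _ _)).
Qed.

Lemma low_sum N (I : finType) (F : I -> {poly A}) :
  (forall i, low N (F i)) -> low N (\sum_i F i).
Proof. by move=> lF; elim/big_ind: _ => //; [exact: low0 | exact: lowD]. Qed.

Lemma low_deriv N p : low N p -> low N.-1 p^`().
Proof.
by case: N => [|N] lp i iN //=; rewrite coef_deriv lp ?mul0rn.
Qed.

End Low.

(** * The Hamilton-Jacobi equation and the iterated Laplacians *)

Section HamiltonJacobi.
Variables (K : numFieldType) (A : comAlgType K) (r : nat).
Variable D : 'I_r -> {additive A -> A}.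
Hypothesis DM : forall k, leibniz (D k).
Hypothesis DC : forall k l x, D k (D l x) = D l (D k x).
Implicit Types (p Q : {poly A}).

(** The spatial derivation acts on coefficients only, so the polynomial variable t is a constant for
    it. *)
Definition liftD k : {additive {poly A} -> {poly A}} := map_poly (D k).

Arguments liftD : simpl never.

Lemma coef_liftD k p i : (liftD k p)`_i = D k p`_i.
Proof. exact: coef_map. Qed.

Lemma low_liftD N k p : low N p -> low N (liftD k p).
Proof. by move=> lp i iN; rewrite coef_liftD lp // raddf0. Qed.

Lemma liftDM k : leibniz (liftD k).
Proof.
move=> p q; apply/polyP => i.
rewrite coefD coef_liftD !coefM raddf_sum -big_split.
by apply: eq_bigr => j _; rewrite DM !coef_liftD.
Qed.

Lemma liftDC k l p : liftD k (liftD l p) = liftD l (liftD k p).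
Proof. by apply/polyP => i; rewrite !coef_liftD DC. Qed.

Lemma liftD_deriv k p : liftD k p^`() = (liftD k p)^`().
Proof. by apply/polyP => i; rewrite coef_deriv !coef_liftD coef_deriv raddfMn. Qed.

Lemma mulrn_inj0 (x : A) n : (0 < n)%N -> x *+ n = 0 -> x = 0.
Proof.
move=> n_gt0 /eqP; rewrite -scaler_nat scaler_eq0 Num.Theory.pnatr_eq0.
by rewrite eqn0Ngt n_gt0 => /eqP.
Qed.

Lemma mulrn_inj (x y : A) n : (0 < n)%N -> x *+ n = y *+ n -> x = y.
Proof.
move=> n_gt0 /eqP; rewrite -subr_eq0 -mulrnBl => /eqP /(mulrn_inj0 n_gt0) /eqP.
by rewrite subr_eq0 => /eqP.
Qed.

Lemma low_mulrn_inj N p n : (0 < n)%N -> low N (p *+ n) -> low N p.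
Proof.
by move=> n_gt0 lp i iN; apply: (mulrn_inj0 n_gt0); rewrite -coefMn lp.
Qed.

(** The equation is solved one coefficient at a time: its t^N coefficient determines that of t^(N+1)
    in Q. *)
Lemma hamilton_jacobi_exists P N :
  exists2 Q : {poly A}, Q`_0 = P & low N (Q^`() *+ 2 - gradsq liftD Q).
Proof.
elim: N => [|N [Q Q0 lQ]]; first by exists P%:P; rewrite ?coefC.
(* Adding c t^(N+1) to Q adds 2 (N+1) c to the t^N coefficient of 2 Q', which cancels the defect
   there; the gradient term changes only from order N+1 on. *)
pose c := (N.+1 * 2)%:R^-1 *: (gradsq liftD Q - Q^`() *+ 2)`_N.
have cE : c *+ (N.+1 * 2) = (gradsq liftD Q - Q^`() *+ 2)`_N.
  by rewrite -scaler_nat scalerA mulfV ?scale1r // Num.Theory.pnatr_eq0.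
pose w := c%:P * 'X^(N.+1).
have wE i : w`_i = if i == N.+1 then c else 0.
  by rewrite /w coefCM coefXn; case: (_ == _); rewrite ?mulr1 ?mulr0.
have lw : low N.+1 w by move=> i iN; rewrite wE ltn_eqF.
exists (Q + w); first by rewrite coefD wE addr0.
have lg : low N.+1 (gradsq liftD Q - gradsq liftD (Q + w)).
  rewrite /gradsq -sumrB; apply: low_sum => k; rewrite raddfD.
  have -> : liftD k Q ^+ 2 - (liftD k Q + liftD k w) ^+ 2
            = - (liftD k Q *+ 2 + liftD k w) * liftD k w by ring.
  by apply/lowMl/low_liftD.
have -> : (Q + w)^`() *+ 2 - gradsq liftD (Q + w)
          = (Q^`() *+ 2 - gradsq liftD Q) + w^`() *+ 2
            + (gradsq liftD Q - gradsq liftD (Q + w)).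
  by rewrite derivD mulrnDl; ring.
apply: lowD lg => i; rewrite ltnS leq_eqVlt coefD coefMn coef_deriv wE => /predU1P[->|iN].
  by rewrite eqxx -mulrnA cE -coefD addrC -opprB addNr coef0.
by rewrite lQ // add0r eqSS ltn_eqF // !mul0rn.
Qed.

Lemma coef_lap p i : (lap liftD p)`_i = lap D p`_i.
Proof. by rewrite /lap coef_sum; apply: eq_bigr => k _; rewrite !coef_liftD. Qed.

Lemma lapMn x n : lap D (x *+ n) = lap D x *+ n.
Proof. by rewrite /lap -sumrMnl; apply: eq_bigr => k _; rewrite !raddfMn. Qed.

Section Truncated.
Variables (N : nat) (Q : {poly A}).
Hypothesis HJ : low N (Q^`() *+ 2 - gradsq liftD Q).

(** By the chain rule and [lapX], the difference is k (k+1) Q^(k-1) times the Hamilton-Jacobi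
    defect, minus (k+1) Q^k times the Laplacian of Q. *)
Lemma low_deriv_exp j k : (j <= N)%N -> low j (lap liftD Q) ->
  low j ((Q ^+ k)^`() *+ (2 * k.+1) - lap liftD (Q ^+ k.+1)).
Proof.
move=> jN lQ; rewrite (lapX _ _ liftDM) deriv_exp.
have -> : (Q^`() * Q ^+ k.-1) *+ k *+ (2 * k.+1) -
    ((Q ^+ k * lap liftD Q) *+ k.+1 + (Q ^+ k.-1 * gradsq liftD Q) *+ (k.+1 * k))
  = (Q ^+ k.-1 * (Q^`() *+ 2 - gradsq liftD Q)) *+ (k.+1 * k)
    - (Q ^+ k * lap liftD Q) *+ k.+1.
  by move: (lap _ _) (gradsq _ _) (Q^`()) (Q ^+ k.-1) (Q ^+ k) => *; ring.
apply: lowD; last by apply/lowN/lowMn/lowMl.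
by apply/lowMn/lowMl/(low_le jN).
Qed.

(** Each use of [low_deriv_exp] lowers i by one, raises k by one and applies one Laplacian; the
    factors 2 (k+1) and i+1 accumulate into the powers and factorials. Order j reaches i = j because
    the relation concerns a t-derivative. *)
Lemma coef_exp_iter_lap j i k : (j <= N)%N -> low j (lap liftD Q) -> (i <= j)%N ->
  (Q ^+ k)`_i *+ (2 ^ i * i`! * (k + i)`!)
  = iter i (lap D) (Q`_0 ^+ (k + i)) *+ k`!.
Proof.
move=> jN lQ; elim: i k => [|i IHi] k ij.
  by rewrite addn0 fact0 expn0 !mul1n; congr (_ *+ _); exact: (rmorphXn (coefp 0)).
have := low_deriv_exp k jN lQ ij; rewrite coefB coefMn coef_deriv coef_lap => /eqP.
rewrite subr_eq0 => /eqP step.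
apply: (@mulrn_inj _ _ k.+1) => //.
have := congr1 (lap D) (IHi k.+1 (ltnW ij)); rewrite !lapMn -iterS -step.
rewrite addSnnS -!mulrnA => eq1.
transitivity ((Q ^+ k)`_i.+1 *+ (i.+1 * (2 * k.+1 * (2 ^ i * i`! * (k + i.+1)`!)))).
  by congr (_ *+ _); rewrite expnS factS; ring.
by rewrite eq1 factS mulnC.
Qed.

End Truncated.

(** Bootstrapping on j: once the Laplacian of Q is O(t^j), its t^j coefficient is a multiple of the
    (j+1)-st iterated Laplacian of P^(j+1), hence zero. *)
Lemma lap_nilpotent_low P N Q :
    low N (Q^`() *+ 2 - gradsq liftD Q) -> Q`_0 = P ->
    (forall m, (1 <= m)%N -> iter m (lap D) (P ^+ m) = 0) ->
  low N.+1 (lap liftD Q).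
Proof.
move=> HJ Q0 nilP; suff: forall j, (j <= N.+1)%N -> low j (lap liftD Q) by exact.
elim=> [//|j IHj] jN; have lj := IHj (ltnW jN).
move=> i; rewrite ltnS leq_eqVlt => /predU1P[->|]; last exact: lj.
have := coef_exp_iter_lap HJ 1 jN lj (leqnn j); rewrite expr1 Q0 => /(congr1 (lap D)).
rewrite !lapMn -iterS add1n nilP // mul0rn -coef_lap; apply: mulrn_inj0.
by rewrite !muln_gt0 expn_gt0 !fact_gt0.
Qed.

Lemma low_lap_nilpotent P N Q :
    low N (Q^`() *+ 2 - gradsq liftD Q) -> Q`_0 = P ->
    low N.+1 (lap liftD Q) -> iter N.+1 (lap D) (P ^+ N.+1) = 0.
Proof.
move=> HJ Q0 lQ; have := coef_exp_iter_lap HJ 1 (leqnn N) (low_le (leqnSn N) lQ) (leqnn N).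
rewrite expr1 Q0 add1n => /(congr1 (lap D)); rewrite !lapMn -coef_lap lQ // mul0rn.
by move/esym; apply: mulrn_inj0.
Qed.

(** * The convective derivative along -grad Q, and the evolution of the Hessian *)

Definition transport Q p := p^`() - \sum_k liftD k Q * liftD k p.

Fact transport_is_zmod_morphism Q : zmod_morphism (transport Q).
Proof.
move=> p q; rewrite /transport derivB.
have -> : \sum_k liftD k Q * liftD k (p - q)
          = \sum_k liftD k Q * liftD k p - \sum_k liftD k Q * liftD k q.
  by rewrite -sumrB; apply: eq_bigr => k _; rewrite raddfB mulrBr.
by ring.
Qed.

HB.instance Definition _ Q := GRing.isZmodMorphism.Build {poly A} {poly A}
  (transport Q) (transport_is_zmod_morphism Q).

Lemma transportM Q : leibniz (transport Q).
Proof.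
move=> p q; rewrite /transport derivM mulrBl mulrBr mulr_suml mulr_sumr.
rewrite addrACA -opprD -big_split /=; congr (_ - _); apply: eq_bigr => k _.
by rewrite liftDM; ring.
Qed.

Lemma low_transport N Q p : low N p -> low N.-1 (transport Q p).
Proof.
move=> lp; apply: lowD; first exact: low_deriv.
by apply/lowN/low_sum => k; apply/lowMl/low_liftD/(low_le (leq_pred N)).
Qed.

Section Evolution.
Variables (N : nat) (Q : {poly A}).
Hypothesis HJ : low N (Q^`() *+ 2 - gradsq liftD Q).
Let H := hess liftD Q.

(** Differentiate the Hamilton-Jacobi equation along a and b: the third derivatives of Q form the
    convection term, the products of second derivatives form H^2. The common factor 2 is then
    removed. *)
Lemma low_hess_transport a b : low N (transport Q (H a b) - (H *m H) a b).
Proof.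
apply: (@low_mulrn_inj _ _ 2) => //.
suff -> : (transport Q (H a b) - (H *m H) a b) *+ 2
          = liftD a (liftD b (Q^`() *+ 2 - gradsq liftD Q)).
  by do 2! apply: low_liftD.
have gradE k : liftD a (liftD b (liftD k Q ^+ 2))
             = (H a k * H k b + liftD k Q * liftD k (H a b)) *+ 2.
  rewrite !mxE expr2 !(liftDM, raddfD) !(liftDC b k) !(liftDC a k).
  by ring.
have -> : liftD a (liftD b (Q^`() *+ 2 - gradsq liftD Q))
          = (H a b)^`() *+ 2 - \sum_k liftD a (liftD b (liftD k Q ^+ 2)).
  rewrite mxE raddfB [in LHS]raddfB !raddfMn !liftD_deriv; congr (_ - _).
  by rewrite /gradsq !raddf_sum.
rewrite (eq_bigr _ (fun k _ => gradE k)) sumrMnl big_split /transport /=.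
by rewrite [(H *m H) _ _]mxE; ring.
Qed.

Lemma low_traces_transport m :
  low N (transport Q (\tr (H ^+ m.+1)) - \tr (H ^+ m.+2) *+ m.+1).
Proof.
rewrite (leibniz_mxtraceX (transportM Q)) -mulrnBl; apply: lowMn => /=.
have -> : H ^+ m.+2 = H ^+ m *m (H *m H) by rewrite !exprSr -mulrA.
rewrite -raddfB -mulmxBr; apply: low_sum => a; rewrite mxE; apply: low_sum => b.
by apply: lowMl; have := low_hess_transport b a; rewrite !mxE.
Qed.

(** Starting from tr H, the Laplacian of Q, each next trace is up to a factor the transport of the
    previous one; the t-derivative costs one order each time. *)
Lemma low_traces m : low N (lap liftD Q) -> low (N - m) (\tr (H ^+ m.+1)).
Proof.
move=> lQ; elim: m => [|m IHm].
  rewrite subn0 expr1; suff -> : \tr H = lap liftD Q by [].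
  by apply: eq_bigr => k _; rewrite mxE.
apply: (@low_mulrn_inj _ _ m.+1) => //.
have -> : \tr (H ^+ m.+2) *+ m.+1 = transport Q (\tr (H ^+ m.+1))
   - (transport Q (\tr (H ^+ m.+1)) - \tr (H ^+ m.+2) *+ m.+1).
  by rewrite opprB addrC subrK.
apply: lowD; first by rewrite subnS; apply: low_transport.
by apply/lowN/(low_le (leq_subr _ _))/low_traces_transport.
Qed.

Lemma coef0_traces m : (\tr (H ^+ m))`_0 = \tr (hess D Q`_0 ^+ m).
Proof.
have -> : hess D Q`_0 = map_mx (coefp 0 : {rmorphism {poly A} -> A}) H.
  by apply/matrixP => a b; rewrite !mxE /= !coef_liftD.
by rewrite -map_mxtraceX.
Qed.

Lemma low_lap_traces :
  (forall m, (1 <= m)%N -> \tr (hess D Q`_0 ^+ m) = 0) -> low N.+1 (lap liftD Q).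
Proof.
(* Induction on j for all m at once: the t-derivative of one trace is governed by the next trace and
   by spatial derivatives of the same trace, all O(t^j), while the constant terms vanish by
   [trP]. *)
move=> trP; have lj j m : (j <= N.+1)%N -> low j (\tr (H ^+ m.+1)).
  elim: j m => [//|j IHj] m jN [_|i ij]; first by rewrite coef0_traces trP.
  have lm := IHj m (ltnW jN).
  apply: (@mulrn_inj0 _ i.+1) => //; rewrite -coef_deriv.
  have -> : (\tr (H ^+ m.+1))^`()
    = (transport Q (\tr (H ^+ m.+1)) - \tr (H ^+ m.+2) *+ m.+1)
      + (\tr (H ^+ m.+2) *+ m.+1 + \sum_k liftD k Q * liftD k (\tr (H ^+ m.+1))).
    by rewrite /transport; ring.
  move: i ij; apply: lowD; first exact/(low_le (jN : (j <= N)%N))/low_traces_transport.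
  apply: lowD; first exact/lowMn/IHj/ltnW.
  by apply: low_sum => k; apply/lowMl/low_liftD.
have := lj N.+1 0 (leqnn _); suff -> : \tr (H ^+ 1) = lap liftD Q by [].
by apply: eq_bigr => k _; rewrite mxE.
Qed.

End Evolution.

Lemma lap_nilpotent_tracesP P :
  (forall m, (1 <= m)%N -> iter m (lap D) (P ^+ m) = 0) <->
  (forall m, (1 <= m)%N -> \tr (hess D P ^+ m) = 0).
Proof.
split=> [nilP|trP] [//|m] _.
  (* [low_traces] loses m orders, so precision m+1 leaves exactly the constant coefficient. *)
  have [Q Q0 HJ] := hamilton_jacobi_exists P m.+1.
  have lQ := low_le (leqnSn m.+1) (lap_nilpotent_low HJ Q0 nilP).
  by rewrite -Q0 -coef0_traces; apply: (low_traces HJ (m := m) lQ); rewrite subSnn.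
have [Q Q0 HJ] := hamilton_jacobi_exists P m.
apply: (low_lap_nilpotent HJ Q0); apply: low_lap_traces => // k.
by rewrite Q0; apply: trP.
Qed.

End HamiltonJacobi.

(** * Directional derivatives along the columns of U *)

Definition dirderiv (K : comNzRingType) (n : nat) (u : 'cV[K]_n) (P : {mpoly K[n]}) :=
  \sum_i u i 0 *: P^`M(i).

Section DirectionalDerivative.
Variables (K : comNzRingType) (n : nat) (u : 'cV[K]_n).

Fact dirderiv_is_zmod_morphism : zmod_morphism (dirderiv u).
Proof.
move=> P Q; rewrite /dirderiv -sumrB; apply: eq_bigr => i _.
by rewrite raddfB scalerBr.
Qed.

HB.instance Definition _ := GRing.isZmodMorphism.Build {mpoly K[n]} {mpoly K[n]}
  (dirderiv u) dirderiv_is_zmod_morphism.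

Lemma dirderivM : leibniz (dirderiv u).
Proof.
move=> P Q; rewrite /dirderiv mulr_suml mulr_sumr -big_split.
by apply: eq_bigr => i _; rewrite mderivM scalerDr -scalerAl -scalerAr.
Qed.

Lemma dirderiv2 v P :
  dirderiv u (dirderiv v P) = \sum_i \sum_j (u i 0 * v j 0) *: P^`M(j)^`M(i).
Proof.
rewrite /dirderiv; apply: eq_bigr => i _; rewrite (raddf_sum (mderiv i)) scaler_sumr.
by apply: eq_bigr => j _; rewrite /= mderivZ scalerA.
Qed.

End DirectionalDerivative.

Lemma dirderivC (K : comNzRingType) n (u v : 'cV[K]_n) P :
  dirderiv u (dirderiv v P) = dirderiv v (dirderiv u P).
Proof.
rewrite !dirderiv2 exchange_big; apply: eq_bigr => i _; apply: eq_bigr => j _.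
by rewrite mderiv_comm mulrC.
Qed.

(** This splits A into the rank-one matrices u u^T, u running over the first r columns of U, and so
    turns its Laplacian into a sum of squares. *)
Lemma pid_mx_gram (K : comNzRingType) n r (le_rn : (r <= n)%N) (U : 'M[K]_n) i j :
  (U *m pid_mx r *m U^T) i j
  = \sum_(k < r) U i (widen_ord le_rn k) * U j (widen_ord le_rn k).
Proof.
transitivity (\sum_(k < n | (k < r)%N) U i k * U j k); last first.
  by rewrite (big_ord_narrow le_rn).
rewrite mxE [RHS]big_mkcond; apply: eq_bigr => k _; rewrite !mxE (bigD1 k) //=.
rewrite big1 => [|l /negPf l'k]; last by rewrite mxE (inj_eq val_inj) l'k mulr0.
by rewrite mxE eqxx addr0 /=; case: (k < r)%N; rewrite ?mulr1 // mulr0 mul0r.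
Qed.

Lemma Laplacian_lap (K : comNzRingType) n r (le_rn : (r <= n)%N) (U : 'M[K]_n) P :
  Laplacian (U *m pid_mx r *m U^T) P
  = lap (fun k : 'I_r => dirderiv (col (widen_ord le_rn k) U)) P.
Proof.
rewrite /lap; under [RHS]eq_bigr do rewrite dirderiv2.
rewrite exchange_big; apply: eq_bigr => i _; rewrite exchange_big.
apply: eq_bigr => j _; rewrite -scaler_suml (pid_mx_gram le_rn); congr (_ *: _).
by apply: eq_bigr => k _; rewrite !mxE.
Qed.

Lemma leading_submx_hess (K : comNzRingType) n r (le_rn : (r <= n)%N)
    (U : 'M[K]_n) P :
  leading_submx le_rn ((mpolyC_mx n U)^T *m Hessian P *m mpolyC_mx n U)
  = hess (fun k : 'I_r => dirderiv (col (widen_ord le_rn k) U)) P.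
Proof.
apply/matrixP => k l; rewrite !mxE dirderiv2 exchange_big.
apply: eq_bigr => j _; rewrite !mxE mulr_suml; apply: eq_bigr => i _.
by rewrite !mxE -mul_mpolyC mpolyCM; ring.
Qed.

Lemma pchar_mpoly (K : numFieldType) n : [pchar {mpoly K[n]}] =i pred0.
Proof.
move=> p; rewrite -[RHS](Num.Theory.pchar_num K p) !inE; congr (_ && _).
by rewrite -(rmorph_nat (@mpolyC n K)) mpolyC_eq0.
Qed.

Lemma leading_submx_id (S : Type) n (le_nn : (n <= n)%N) (M : 'M[S]_n) :
  leading_submx le_nn M = M.
Proof. by apply/matrixP => i j; rewrite mxE; congr (M _ _); apply: val_inj. Qed.

Theorem proposition3p4 (R : realType) (n r : nat) (n_ge1 : (1 <= n)%N)
    (r_ge1 : (1 <= r)%N) (le_rn : (r <= n)%N)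
    (A U : 'M[R[i]]_n) (symA : A^T = A) (rankA : \rank A = r)
    (unitU : U \in unitmx) (defA : A = U *m pid_mx r *m U^T) :
  (forall P : {mpoly R[i][n]},
     Laplacian_nilpotent A P <->
     nilpotent_mx (leading_submx le_rn
       ((mpolyC_mx n U)^T *m Hessian P *m mpolyC_mx n U)))
  /\ (r = n ->
      forall P : {mpoly R[i][n]},
        Laplacian_nilpotent A P <->
        nilpotent_mx ((mpolyC_mx n U)^T *m Hessian P *m mpolyC_mx n U)).
Proof.
have main P : Laplacian_nilpotent A P <->
    nilpotent_mx (leading_submx le_rn
       ((mpolyC_mx n U)^T *m Hessian P *m mpolyC_mx n U)).
  pose D k := dirderiv (col (widen_ord le_rn k) U) : {additive {mpoly R[i][n]} -> _}.
  have DM k : leibniz (D k) by exact: dirderivM.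
  have DC k l x : D k (D l x) = D l (D k x) by exact: dirderivC.
  rewrite leading_submx_hess (nilpotent_mx_tracesP _ (@pchar_mpoly _ n)).
  rewrite -[X in _ <-> X](lap_nilpotent_tracesP DM DC).
  have eqL : Laplacian A =1 lap D by move=> Q; rewrite defA (Laplacian_lap le_rn).
  by split=> nilP m /nilP; rewrite (eq_iter eqL).
(* The proof [le_rn] is generalised because its type mentions [r], which is replaced by [n]. *)
split=> // eq_rn P; rewrite main; move: (le_rn); rewrite eq_rn => le_nn.
by rewrite leading_submx_id.
Qed.
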